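(* Let $A\subset\mathbb{N}$, and let $\psi,\varphi\in\mathcal{D}$ satisfy $$\sum_{k=1}^n\psi'(k)\sim\psi(n)\quad\text{and}\quad\sum_{k=1}^n\varphi'(k)\sim\varphi(n),\qquad n\to\infty.$$ If $$0<c_1=\liminf_{x\to\infty}\frac{\psi'(x)}{\varphi'(x)}\le\limsup_{x\to\infty}\frac{\psi'(x)}{\varphi'(x)}=c_2<\infty,$$ then $$\frac1c\cdot\underline{\operatorname{d}}_{\varphi}(A)\le\underline{\operatorname{d}}_{\psi}(A)\le c\cdot\underline{\operatorname{d}}_{\varphi}(A)\quad\text{and}\quad\frac1c\cdot\overline{\operatorname{d}}_{\varphi}(A)\le\overline{\operatorname{d}}_{\psi}(A)\le c\cdot\overline{\operatorname{d}}_{\varphi}(A),$$ where $c=c_2/c_1$. In particular, if $c=1$, then $\underline{\operatorname{d}}_{\psi}(A)=\underline{\operatorname{d}}_{\varphi}(A)$ and $\overline{\operatorname{d}}_{\psi}(A)=\overline{\operatorname{d}}_{\varphi}(A)$.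
   Context: $\mathbb{N}=\{1,2,3,\dots\}$ and $\chi_A$ is the characteristic function of $A$. $\mathcal{D}$ denotes the class of strictly increasing, differentiable, unbounded functions $\psi:(0,\infty)\to(0,\infty)$; for such functions it is understood that $\psi'(x)>0$ for all $x>0$. For $\psi\in\mathcal{D}$ and $A\subset\mathbb{N}$, the lower and upper $\psi$-densities are $$\underline{\operatorname{d}}_\psi(A)=\liminf_{n\to\infty}\frac{\sum_{k=1}^n\psi'(k)\chi_A(k)}{\sum_{k=1}^n\psi'(k)},\qquad \overline{\operatorname{d}}_\psi(A)=\limsup_{n\to\infty}\frac{\sum_{k=1}^n\psi'(k)\chi_A(k)}{\sum_{k=1}^n\psi'(k)}.$$ The notation $f(n)\sim g(n)$ means $f(n)/g(n)\to1$. *)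

(* Defs.v *)
From HB Require Import structures.
From mathcomp Require Import all_boot all_order all_algebra.
From mathcomp Require Import all_classical all_reals all_analysis.

Set Implicit Arguments.
Unset Strict Implicit.
Unset Printing Implicit Defensive.

Import Order.TTheory GRing.Theory Num.Theory.
Import numFieldNormedType.Exports.

Local Open Scope classical_set_scope.
Local Open Scope ring_scope.

(* A function (0,oo) -> (0,oo) is represented by a total function R -> R of
   which only the values on (0,oo) matter: the derivative at x > 0 depends only
   on the values of psi near x. *)
Record classD (R : realType) (psi : R -> R) : Prop := ClassD {
  classD_pos : forall x : R, 0 < x -> 0 < psi x;
  classD_incr : forall x y : R, 0 < x -> x < y -> psi x < psi y;
  classD_derivable : forall x : R, 0 < x -> derivable psi x 1;
  classD_unbounded : forall M : R, exists2 x : R, 0 < x & M < psi x;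
  classD_derive_pos : forall x : R, 0 < x -> 0 < derive1 psi x
}.

Definition sum_derive (R : realType) (psi : R -> R) (n : nat) : R :=
  \sum_(1 <= k < n.+1) derive1 psi k%:R.

Definition density_ratio (R : realType) (psi : R -> R) (A : set nat) (n : nat)
    : R :=
  (\sum_(1 <= k < n.+1) derive1 psi k%:R * \1_A k) / sum_derive psi n.

(* The value of the ratio at n = 0, where it is 0 / 0, is irrelevant. *)
Definition lower_density (R : realType) (psi : R -> R) (A : set nat) : \bar R :=
  limn_einf (fun n => (density_ratio psi A n)%:E).

Definition upper_density (R : realType) (psi : R -> R) (A : set nat) : \bar R :=
  limn_esup (fun n => (density_ratio psi A n)%:E).

Definition asymp_equiv (R : realType) (f g : nat -> R) : Prop :=
  f n / g n @[n --> \oo] --> (1 : R).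

(* Main.v *)
Require Import Defs.
From HB Require Import structures.
From mathcomp Require Import all_boot all_order all_algebra.
From mathcomp Require Import all_classical all_reals all_analysis.
From mathcomp Require Import ring lra.

(** Both conclusions come from a single comparison of the density quotients.
    Write [S_psi(n)] for the sum of [psi'] up to [n] and [r_psi(n)] for the
    quotient whose liminf and limsup are the densities of [A].  If
    [a * phi' <= psi' <= b * phi'] holds from some point on, then, up to
    additive constants, the numerator of [r_psi] is at most [b] times that of
    [r_phi], while [S_psi >= a * S_phi].  Since [S_psi] tends to infinity the
    constants are negligible, whence [r_psi <= (b / a) * r_phi + delta]
    eventually, for every [delta > 0] ([density_ratio_comparison]).

    By definition of [c1] and [c2], every [a < c1] and every [b > c2] are
    eventually such bounds; as quotients lie in [[0, 1]] and [b / a] can be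
    brought arbitrarily close to [c = c2 / c1], one may take [b / a = c]
    ([density_ratio_bound]).  The relation [a * phi' <= psi' <= b * phi'] is
    equivalent to [psi' / b <= phi' <= psi' / a], whose quotient of bounds is
    again [b / a], so the same inequality holds with [psi] and [phi]
    exchanged.  Passing to upper and lower limits in the two inequalities
    gives the four bounds, and equality of the densities when [c = 1].

    The asymptotic hypotheses enter through the divergence of [S_psi] and
    [S_phi], inherited from that of [psi(n)] and [phi(n)]
    ([sum_derive_cvgy]). *)

Set Implicit Arguments.
Unset Strict Implicit.
Unset Printing Implicit Defensive.

Import Order.TTheory GRing.Theory Num.Theory.
Import numFieldNormedType.Exports.

Local Open Scope classical_set_scope.
Local Open Scope ring_scope.

(** * Upper and lower limits along a filter *)

Lemma lee_of_lt_fin (R : realType) (x y : \bar R) :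
  (forall z : R, (y < z%:E)%E -> (x <= z%:E)%E) -> (x <= y)%E.
Proof.
case: y => [r||] H; last 2 first.
- by rewrite leey.
- case: x H => [r||] H //.
    by exfalso; have := H (r - 1) (ltNyr _); rewrite lee_fin; lra.
  by have := H 0 (ltNyr _); rewrite leye_eq.
- apply/lee_addgt0Pr => e e0; rewrite -EFinD; apply: H.
  by rewrite lte_fin ltrDl.
Qed.

Lemma limf_esup_lt_near (R : realType) (T : choiceType) (X : filteredType T)
    (F : set_system X) (FF : Filter F) (f : X -> \bar R) (y : \bar R) :
  (limf_esup f F < y)%E -> \forall x \near F, (f x < y)%E.
Proof.
move=> /ereal_inf_lt[_ [V FV <-]] Vy; apply: filterS FV => x Vx.
by apply: le_lt_trans Vy; apply: ereal_sup_ubound; exists x.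
Qed.

Lemma limf_einf_gt_near (R : realType) (T : choiceType) (X : filteredType T)
    (F : set_system X) (FF : Filter F) (f : X -> \bar R) (y : \bar R) :
  (y < limf_einf f F)%E -> \forall x \near F, (y < f x)%E.
Proof.
rewrite /limf_einf lteNr => /limf_esup_lt_near H.
by apply: filterS H => x /=; rewrite lteNl oppeK.
Qed.

Lemma limf_esup_le_near (R : realType) (T : choiceType) (X : filteredType T)
    (F : set_system X) (f : X -> \bar R) (y : \bar R) :
  (\forall x \near F, (f x <= y)%E) -> (limf_esup f F <= y)%E.
Proof.
move=> H; apply: (@le_trans _ _ (ereal_sup (f @` [set x | (f x <= y)%E]))).
  by apply: ereal_inf_lbound; exists [set x | (f x <= y)%E].
by apply: ge_ereal_sup => _ [x /= fx <-].
Qed.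

Lemma limf_esup_le_scale (R : realType) (T : choiceType) (X : filteredType T)
    (F : set_system X) (FF : Filter F) (u v : X -> R) (K : R) : 0 < K ->
  (forall d, 0 < d -> \forall x \near F, u x <= K * v x + d) ->
  (limf_esup (fun x => (u x)%:E) F <= K%:E * limf_esup (fun x => (v x)%:E) F)%E.
Proof.
move=> K0 uv; rewrite -lee_pdivrMl//; apply: lee_of_lt_fin => z vz.
rewrite lee_pdivrMl// -EFinM; apply/lee_addgt0Pr => d d0.
apply: limf_esup_le_near.
have vz_near := limf_esup_lt_near FF vz.
apply: (@filterS2 _ F FF _ _ _ _ vz_near (uv d d0)) => x.
rewrite lte_fin => vx ux; rewrite -EFinD lee_fin (le_trans ux)// lerD2r.
by rewrite ler_pM2l// ltW.
Qed.

(** Dividing [u <= K * v + d] by [- K] turns it into an inequality of the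
    same shape between [- v] and [- u], so this follows from the case of upper
    limits. *)
Lemma limf_einf_le_scale (R : realType) (T : choiceType) (X : filteredType T)
    (F : set_system X) (FF : Filter F) (u v : X -> R) (K : R) : 0 < K ->
  (forall d, 0 < d -> \forall x \near F, u x <= K * v x + d) ->
  (limf_einf (fun x => (u x)%:E) F <= K%:E * limf_einf (fun x => (v x)%:E) F)%E.
Proof.
move=> K0 uv; rewrite -lee_pdivrMl// /limf_einf muleN leeN2.
apply: (@limf_esup_le_scale _ _ _ _ _ (fun x => - v x) (fun x => - u x)).
  by rewrite invr_gt0.
move=> d d0; apply: filterS (uv (K * d) (mulr_gt0 K0 d0)) => x.
by rewrite -mulrDr -ler_pdivrMl// => ux; lra.
Qed.

(** * Comparison of density quotients *)

(** A termwise inequality that holds from some index on gives an inequality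
    between partial sums up to the finitely many exceptional terms. *)
Lemma sum_le_near (R : realType) (f g : nat -> R) :
  (\forall k \near \oo, f k <= g k) ->
  exists2 C : R, 0 <= C & \forall n \near \oo,
    \sum_(1 <= k < n.+1) f k <= C + \sum_(1 <= k < n.+1) g k.
Proof.
move=> [N _ fg].
pose D n := \sum_(1 <= k < n.+1) f k - \sum_(1 <= k < n.+1) g k.
exists `|D N|; first exact: normr_ge0.
exists N => // n /= Nn; rewrite -lerBlDr -/(D n).
apply: le_trans (ler_norm (D N)).
rewrite -(subnKC Nn); elim: (n - N)%N => [|m IH]; first by rewrite addn0.
apply: le_trans IH; rewrite addnS /D !(@big_nat_recr _ _ _ (N + m).+1)//=.
have := fg (N + m).+1; rewrite /= => /(_ (leqW (leq_addr _ _))); lra.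
Qed.

Lemma sum_derive_cvgy (R : realType) (psi : R -> R) : classD psi ->
  asymp_equiv (sum_derive psi) (fun n : nat => psi n%:R) ->
  sum_derive psi n @[n --> \oo] --> +oo.
Proof.
move=> hpsi hsum; apply/cvgryPge => M.
have [x x0 Mx] := classD_unbounded hpsi (2 * M).
have H : \forall n \near \oo, 2^-1 < sum_derive psi n / psi n%:R.
  by apply: (cvgr_gt _ hsum); lra.
near=> n.
have xn : x < n%:R.
  by near: n; apply: filterS (nbhs_infty_ger (x + 1)) => n; lra.
have n0 : (0 : R) < n%:R by apply: lt_trans xn.
have psin := classD_incr hpsi x0 xn.
have : 2^-1 < sum_derive psi n / psi n%:R by near: n; exact: H.
by rewrite ltr_pdivlMr ?(classD_pos hpsi)//; lra.
Unshelve. all: by end_near.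
Qed.

Lemma sum_derive_gt0 (R : realType) (psi : R -> R) (n : nat) : classD psi ->
  (0 < n)%N -> 0 < sum_derive psi n.
Proof.
move=> hpsi; case: n => // n _; rewrite /sum_derive big_nat_recl//.
apply: ltr_wpDr; first apply: sumr_ge0 => k _.
  by apply/ltW/(classD_derive_pos hpsi); rewrite ltr0n.
by apply: (classD_derive_pos hpsi).
Qed.

Lemma density_ratio_ge0_le1 (R : realType) (psi : R -> R) (A : set nat)
    (n : nat) : classD psi -> (0 < n)%N -> 0 <= density_ratio psi A n <= 1.
Proof.
move=> hpsi n0; have S0 := sum_derive_gt0 hpsi n0.
rewrite /density_ratio ler_pdivlMr// mul0r ler_pdivrMr// mul1r.
have d0 k : (1 <= k)%N -> 0 <= derive1 psi k%:R.
  by move=> k0; apply/ltW/(classD_derive_pos hpsi); rewrite ltr0n.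
apply/andP; split.
  rewrite big_nat_cond; apply: sumr_ge0 => k /andP[/andP[k0 _] _].
  by rewrite mulr_ge0 ?d0// indicE ler0n.
rewrite /sum_derive !big_nat; apply: ler_sum => k /andP[k0 _].
by rewrite ler_piMr ?d0// indicE; case: (_ \in _).
Qed.

Lemma density_ratio_comparison (R : realType) (psi phi : R -> R)
    (A : set nat) (a b d : R) :
  classD psi -> classD phi -> 0 < a -> 0 < b -> 0 < d ->
  sum_derive psi n @[n --> \oo] --> +oo ->
  (\forall k \near \oo, a * derive1 phi k%:R <= derive1 psi k%:R
                          <= b * derive1 phi k%:R) ->
  \forall n \near \oo,
    density_ratio psi A n <= b / a * density_ratio phi A n + d.
Proof.
move=> hpsi hphi a0 b0 d0 Sy ab.
have [C C0 HC] : exists2 C : R, 0 <= C & \forall n \near \oo,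
    \sum_(1 <= k < n.+1) derive1 psi k%:R * \1_A k <=
    C + b * \sum_(1 <= k < n.+1) derive1 phi k%:R * \1_A k.
  have [|C C0 HC] := @sum_le_near _ (fun k => derive1 psi k%:R * \1_A k)
    (fun k => b * (derive1 phi k%:R * \1_A k)).
    apply: filterS ab => k /andP[_ H].
    by rewrite mulrA ler_wpM2r// indicE ler0n.
  by exists C => //; apply: filterS HC => n; rewrite -mulr_sumr.
have [C' C'0 HC'] : exists2 C' : R, 0 <= C' & \forall n \near \oo,
    a * sum_derive phi n <= C' + sum_derive psi n.
  have [|C' C'0 HC'] := @sum_le_near _ (fun k => a * derive1 phi k%:R)
    (fun k => derive1 psi k%:R).
    by apply: filterS ab => k /andP[].
  by exists C' => //; apply: filterS HC' => n; rewrite -mulr_sumr.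
(* this lower bound on the denominator makes the constants cost at most d *)
have /cvgryPge/(_ ((C + b / a * C') / d)) big_S := Sy.
near=> n.
have n0 : (0 < n)%N by near: n; exact: nbhs_infty_gt.
have /andP[r0 r1] := density_ratio_ge0_le1 A hphi n0.
have P0 := sum_derive_gt0 hpsi n0.
have Q0 := sum_derive_gt0 hphi n0.
have : (C + b / a * C') / d <= sum_derive psi n by near: n.
rewrite ler_pdivrMr// => Pd.
have num_le : \sum_(1 <= k < n.+1) derive1 psi k%:R * \1_A k <=
    C + b * \sum_(1 <= k < n.+1) derive1 phi k%:R * \1_A k by near: n.
have den_ge : a * sum_derive phi n <= C' + sum_derive psi n by near: n.
rewrite {1}/density_ratio ler_pdivrMr// (le_trans num_le)//.
have -> : \sum_(1 <= k < n.+1) derive1 phi k%:R * \1_A k =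
    density_ratio phi A n * sum_derive phi n.
  by rewrite /density_ratio divfK// gt_eqF.
set r := density_ratio phi A n in r0 r1 *.
set P := sum_derive psi n in P0 Pd den_ge *.
set Q := sum_derive phi n in Q0 den_ge *.
have ba0 : 0 < b / a by rewrite divr_gt0.
have -> : b * (r * Q) = b / a * r * (a * Q).
  by rewrite mulrACA -mulrA [r * _]mulrC; field; rewrite gt_eqF.
apply: (@le_trans _ _ (C + b / a * r * (C' + P))).
  by rewrite lerD2l ler_wpM2l// mulr_ge0// ltW.
have : b / a * C' * r <= b / a * C' by rewrite ler_piMr// mulr_ge0// ltW.
lra.
Unshelve. all: by end_near.
Qed.

(** As the quotients are at most [1], it is enough to choose [a < c1] and
    [b > c2] with [b / a <= c2 / c1 + d / 2]. *)
Lemma density_ratio_bound (R : realType) (psi phi : R -> R) (A : set nat)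
    (c1 c2 d : R) :
  classD psi -> classD phi -> 0 < c1 -> 0 < c2 -> 0 < d ->
  sum_derive psi n @[n --> \oo] --> +oo ->
  (forall a b, 0 < a -> a < c1 -> c2 < b ->
    \forall k \near \oo, a * derive1 phi k%:R <= derive1 psi k%:R
                           <= b * derive1 phi k%:R) ->
  \forall n \near \oo,
    density_ratio psi A n <= c2 / c1 * density_ratio phi A n + d.
Proof.
move=> hpsi hphi c10 c20 d0 Sy ab.
have c0 : 0 < c2 / c1 by rewrite divr_gt0.
have [t [t0 t1 td]] : exists t : R, [/\ 0 < t, t < 1 &
    c2 / c1 * (1 + t) / (1 - t) <= c2 / c1 + d / 2].
  (* with c = c2 / c1, the last condition reads t <= (d/2) / (2 c + d/2) *)
  set c := c2 / c1 in c0 *.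
  have e0 : 0 < 2 * c + d / 2 by lra.
  exists ((d / 2) / (2 * c + d / 2)).
  have t1 : (d / 2) / (2 * c + d / 2) < 1 by rewrite ltr_pdivrMr//; lra.
  split=> //; first by rewrite divr_gt0//; lra.
  rewrite ler_pdivrMr ?subr_gt0// -subr_ge0.
  have := divfK (lt0r_neq0 e0) (d / 2).
  by set t := d / 2 / _; lra.
have t10 : 0 < 1 - t by lra.
have H : \forall k \near \oo, c1 * (1 - t) * derive1 phi k%:R
    <= derive1 psi k%:R <= c2 * (1 + t) * derive1 phi k%:R.
  by apply: ab; [rewrite mulr_gt0|rewrite gtr_pMr//; lra|rewrite ltr_pMr//; lra].
have b0 : 0 < c2 * (1 + t) by rewrite mulr_gt0//; lra.
have d20 : 0 < d / 2 by lra.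
have {}H := density_ratio_comparison A hpsi hphi (mulr_gt0 c10 t10) b0 d20 Sy H.
near=> n.
have n0 : (0 < n)%N by near: n; exact: nbhs_infty_gt.
have /andP[r0 r1] := density_ratio_ge0_le1 A hphi n0.
have : density_ratio psi A n <= c2 * (1 + t) / (c1 * (1 - t)) *
    density_ratio phi A n + d / 2 by near: n.
have -> : c2 * (1 + t) / (c1 * (1 - t)) = c2 / c1 * (1 + t) / (1 - t).
  by rewrite invfM mulrACA !mulrA.
have := ler_wpM2r r0 td.
have : d / 2 * density_ratio phi A n <= d / 2 by rewrite ler_piMr// ltW.
lra.
Unshelve. all: by end_near.
Qed.

(** * Passage to upper and lower densities *)

Theorem theorem2p9 (R : realType) (A : set nat)
    (hA : A `<=` [set k | (1 <= k)%N])
    (psi phi : R -> R) (hpsi : classD psi) (hphi : classD phi)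
    (hpsi_sum : asymp_equiv (sum_derive psi) (fun n : nat => psi n%:R))
    (hphi_sum : asymp_equiv (sum_derive phi) (fun n : nat => phi n%:R))
    (c1 c2 : R) (hc1 : 0 < c1)
    (hliminf :
       limf_einf (fun x : R => (derive1 psi x / derive1 phi x)%:E) (pinfty_nbhs R)
       = c1%:E)
    (hlimsup :
       limf_esup (fun x : R => (derive1 psi x / derive1 phi x)%:E) (pinfty_nbhs R)
       = c2%:E) :
  let c := c2 / c1 in
  [/\ ((1 / c)%:E * lower_density phi A <= lower_density psi A
        <= c%:E * lower_density phi A)%E,
      ((1 / c)%:E * upper_density phi A <= upper_density psi A
        <= c%:E * upper_density phi A)%E &
      c = 1 ->
        lower_density psi A = lower_density phi A /\
        upper_density psi A = upper_density phi A].
Proof.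
have near_ab a b : a < c1 -> c2 < b -> \forall x \near +oo,
    a < derive1 psi x / derive1 phi x < b.
  move=> ac1 c2b.
  have Ha : (a%:E < limf_einf (fun x : R =>
      (derive1 psi x / derive1 phi x)%:E) (pinfty_nbhs R))%E.
    by rewrite hliminf lte_fin.
  have Hb : (limf_esup (fun x : R =>
      (derive1 psi x / derive1 phi x)%:E) (pinfty_nbhs R) < b%:E)%E.
    by rewrite hlimsup lte_fin.
  apply: filterS2 (limf_einf_gt_near _ Ha) (limf_esup_lt_near _ Hb) => x.
  by rewrite !lte_fin => -> ->.
have c20 : 0 < c2.
  rewrite ltNge; apply/negP => c20.
  have /near_ab/(_ _)H : c1 / 2 < c1 by lra.
  have /H{}H : c2 < c1 / 2 by lra.
  have [x /andP[xa xb]] := filter_ex H.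
  by have := lt_trans xa xb; rewrite ltxx.
have near_nat a b : a < c1 -> c2 < b -> \forall k \near \oo,
    a * derive1 phi k%:R <= derive1 psi k%:R <= b * derive1 phi k%:R.
  move=> ac1 c2b.
  have H : \forall k \near \oo, a < derive1 psi k%:R / derive1 phi k%:R < b.
    exact: (@cvgr_idn R _ (near_ab _ _ ac1 c2b)).
  apply: filterS2 H (nbhs_infty_gt 0%N) => k /andP[ka kb] k0.
  have phi0 : 0 < derive1 phi k%:R.
    by apply: (classD_derive_pos hphi); rewrite ltr0n.
  by rewrite -ler_pdivlMr// (ltW ka) -ler_pdivrMr// (ltW kb).
move=> c; have c0 : 0 < c by rewrite /c divr_gt0.
have psi_phi d : 0 < d -> \forall n \near \oo,
    density_ratio psi A n <= c * density_ratio phi A n + d.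
  move=> d0; apply: density_ratio_bound => //; first exact: sum_derive_cvgy.
  by move=> a b _; exact: near_nat.
have phi_psi d : 0 < d -> \forall n \near \oo,
    density_ratio phi A n <= c * density_ratio psi A n + d.
  move=> d0.
  (* the constants 1 / c2 and 1 / c1 bound phi' / psi' *)
  have -> : c = c1^-1 / c2^-1 by rewrite invrK mulrC.
  apply: density_ratio_bound => //; rewrite ?invr_gt0//.
    exact: sum_derive_cvgy.
  move=> a b a0 ac bc.
  have b0 : 0 < b by apply: lt_trans bc; rewrite invr_gt0.
  have ac2 : c2 < a^-1 by rewrite -[c2]invrK ltf_pV2// posrE invr_gt0.
  have bc1 : b^-1 < c1 by rewrite -[c1]invrK ltf_pV2// posrE invr_gt0.
  apply: filterS (near_nat _ _ bc1 ac2) => k /andP[kb ka].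
  by rewrite -ler_pdivlMl// ka /= -ler_pdivrMl.
have FF : Filter (\oo : set_system nat) by exact: _.
have low1 : (lower_density psi A <= c%:E * lower_density phi A)%E.
  exact: (limf_einf_le_scale FF c0 psi_phi).
have low2 : (lower_density phi A <= c%:E * lower_density psi A)%E.
  exact: (limf_einf_le_scale FF c0 phi_psi).
have up1 : (upper_density psi A <= c%:E * upper_density phi A)%E.
  exact: (limf_esup_le_scale FF c0 psi_phi).
have up2 : (upper_density phi A <= c%:E * upper_density psi A)%E.
  exact: (limf_esup_le_scale FF c0 phi_psi).
split; rewrite ?div1r.
- apply/andP; split; [by rewrite (lee_pdivrMl _ _ c0)|exact: low1].
- apply/andP; split; [by rewrite (lee_pdivrMl _ _ c0)|exact: up1].
- move=> c1E; have anti (x y : \bar R) :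
      (x <= c%:E * y)%E -> (y <= c%:E * x)%E -> x = y.
    by rewrite c1E !mul1e => xy yx; apply: le_anti; rewrite xy yx.
  by split; apply: anti.
Qed.
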